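(* Let $(X,\|\cdot\|)$ be a real normed space, let $X_o=X\setminus\{o\}$, and let $\mathrm{ang_p}:X_o\times X_o\to\mathbb{R}$ be its P-angle, $$\mathrm{ang_p}(x,y)=\arccos\left(\frac{\|x\|^2+\|y\|^2-\|x-y\|^2}{2\|x\|\,\|y\|}\right).$$ Then $\mathrm{ang_p}$ is homogeneous, i.e. $\mathrm{ang_p}(\alpha x,\beta y)=\mathrm{ang_p}(x,y)$ for all $x,y\in X_o$ and all $\alpha,\beta>0$, if and only if the norm $\|\cdot\|$ is derived from an inner product.
   Context: $\arccos:[-1,1]\to[0,\pi]$ is the usual inverse cosine. ''Derived from an inner product'' means that there is an inner product $(\cdot,\cdot)$ on $X$ with $\|x\|^2=(x,x)$ for all $x\in X$. *)

(* Defs.v *)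
From HB Require Import structures.
From mathcomp Require Import all_boot all_order all_algebra sesquilinear.
From mathcomp Require Import all_classical all_reals all_analysis.

Set Implicit Arguments.
Unset Strict Implicit.
Unset Printing Implicit Defensive.

Import Order.TTheory GRing.Theory Num.Theory.
Import numFieldNormedType.Exports.

Local Open Scope ring_scope.

(* [pangle x y] is meaningful only for nonzero [x] and [y]: the argument of
   [acos] then lies in [[-1, 1]], by the triangle inequality. *)
Definition pangle (R : realType) (X : normedModType R) (x y : X) : R :=
  acos ((`|x| ^+ 2 + `|y| ^+ 2 - `|x - y| ^+ 2) / (2 * `|x| * `|y|)).

Definition pangle_homogeneous (R : realType) (X : normedModType R) : Prop :=
  forall (x y : X) (a b : R), x != 0 -> y != 0 -> 0 < a -> 0 < b ->
    pangle (a *: x) (b *: y) = pangle x y.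

(* Over a real field, [{dot X for idfun}] is the type of symmetric positive
   definite bilinear forms on [X]. *)
Definition derived_from_inner_product (R : realType) (X : normedModType R) :
    Prop :=
  exists dot : {dot X for idfun}, forall x : X, `|x| ^+ 2 = dot x x.

(* Main.v *)
(** The cosine of the P-angle is [polar x y / (|x| |y|)], where
    [polar x y = (|x|^2 + |y|^2 - |x - y|^2) / 2]; it lies in [[-1, 1]], where
    [acos] is injective, so homogeneity of the angle amounts to
    [polar (a x) (b y) = a b polar x y] for [a, b > 0].  The single instance
    [polar (x - y) (2 (- y)) = 2 polar (x - y) (- y)] is the parallelogram law,
    and the Jordan-von Neumann argument then shows that [polar] is additive;
    real homogeneity needs no continuity argument, since positive scalars are
    covered by hypothesis. *)
Require Import Defs.
From mathcomp Require Import all_boot all_order all_algebra.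
From mathcomp Require Import all_classical all_reals all_analysis.
From HB Require Import structures.
From mathcomp Require Import sesquilinear ring lra.

Set Implicit Arguments.
Unset Strict Implicit.
Unset Printing Implicit Defensive.

Import Order.TTheory GRing.Theory Num.Theory.
Import numFieldNormedType.Exports.

Local Open Scope ring_scope.

Lemma acos_inj (R : realType) : {in `[(-1), 1] &, injective (@acos R)}.
Proof. exact: can_in_inj (@acosK R). Qed.

Lemma dot_of_form (R : numDomainType) (X : lmodType R) (f : X -> X -> R) :
  (forall x y, f x y = f y x) ->
  (forall x y z, f (x + y) z = f x z + f y z) ->
  (forall a x y, f (a *: x) y = a * f x y) ->
  (forall x, x != 0 -> 0 < f x x) ->
  exists dot : {dot X for idfun}, forall x y, dot x y = f x y.
Proof.
move=> fC fD fZ f_gt0.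
have fBl z : zmod_morphism (f ^~ z).
  by move=> x y /=; rewrite fD -scaleN1r fZ mulN1r.
have fBr z : zmod_morphism (f z).
  by move=> x y; rewrite !(fC z); exact: fBl.
have fZl z : scalable_for *%R (f ^~ z) by move=> a x /=; rewrite fZ.
have fZr z : scalable_for (idfun \; *%R) (f z).
  by move=> a x /=; rewrite !(fC z) fZ.
(* Sign exponent [false] and conjugation [idfun] make Hermitian symmetry plain symmetry. *)
have fH x y : f x y = (-1) ^+ false * idfun (f y x).
  by rewrite expr0 mul1r /= fC.
pose bil := isBilinear.Build R X X R *%R (idfun \; *%R) f fBl fBr fZl fZr.
pose herm := isHermitianSesquilinear.Build R X false idfun f fH.
pose posd := isDotProduct.Build R X f f_gt0.
pose dot : {dot X for idfun} := HB.pack f bil herm posd.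
by exists dot.
Qed.

Section Polar.
Variables (R : realType) (X : normedModType R).
Implicit Types (x y z : X) (a b : R).

Definition polar x y : R := (`|x| ^+ 2 + `|y| ^+ 2 - `|x - y| ^+ 2) / 2.

Lemma pangleE x y : pangle x y = acos (polar x y / (`|x| * `|y|)).
Proof. by rewrite /pangle /polar -(mulrA 2) invfM mulrA. Qed.

Lemma polarC x y : polar x y = polar y x.
Proof. by rewrite /polar distrC [X in X - _]addrC. Qed.

Lemma polarxx x : polar x x = `|x| ^+ 2.
Proof. by rewrite /polar subrr normr0; field. Qed.

Lemma polar0r x : polar x 0 = 0.
Proof. by rewrite /polar subr0 normr0; field. Qed.

Lemma polar_itv x y : x != 0 -> y != 0 ->
  polar x y / (`|x| * `|y|) \in `[(-1), 1].
Proof.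
rewrite -!normr_gt0 => x0 y0.
rewrite in_itv /= ler_pdivlMr ?ler_pdivrMr ?mulr_gt0 // /polar.
have h1 := ler_normB x y.
have h2 := lerB_dist x y; have h3 := lerB_dist y x.
rewrite distrC in h3; have h0 := normr_ge0 (x - y).
(* With denominators cleared, the two bounds read [c ^+ 2 <= (a + b) ^+ 2] and
   [(a - b) ^+ 2 <= c ^+ 2]. *)
move: h0 h1 h2 h3; move: `|x - y| `|x| `|y| x0 y0 => c a b.
by move=> *; apply/andP; split; nra.
Qed.

Lemma polarZr_gt0 x y b : pangle_homogeneous X -> 0 < b ->
  polar x (b *: y) = b * polar x y.
Proof.
move=> homX b0.
(* Homogeneity of the angle says nothing about zero vectors, but there both sides vanish. *)
have [->|x0] := eqVneq x 0; first by rewrite !(polarC 0) !polar0r mulr0.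
have [->|y0] := eqVneq y 0; first by rewrite scaler0 polar0r mulr0.
have by0 : b *: y != 0 by rewrite scaler_eq0 negb_or gt_eqF.
have := homX x y 1 b x0 y0 ltr01 b0; rewrite scale1r !pangleE.
move=> /acos_inj -/(_ (polar_itv x0 by0) (polar_itv x0 y0)).
rewrite normrZ gtr0_norm // => /(congr1 ( *%R^~ (`|x| * (b * `|y|)))).
rewrite divfK; last by rewrite !mulf_neq0 ?normr_eq0 // gt_eqF.
by move=> ->; field; rewrite !normr_eq0 x0 y0.
Qed.

Lemma parallelogram_of_homogeneous x y : pangle_homogeneous X ->
  `|x + y| ^+ 2 + `|x - y| ^+ 2 = 2 * `|x| ^+ 2 + 2 * `|y| ^+ 2.
Proof.
(* The differences occurring in the two polar terms are [x + y] and [x], so only norms from the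
   parallelogram law remain. *)
move=> homX; have := polarZr_gt0 (x - y) (- y) homX (ltr0n R 2).
rewrite /polar opprK subrK scalerN normrN opprK normrZ gtr0_norm ?ltr0n //.
have -> : x - y + 2 *: y = x + y by rewrite scaler_nat mulr2n addrA subrK.
rewrite normrN; lra.
Qed.

Section Parallelogram.
Hypothesis parallelogram : forall x y,
  `|x + y| ^+ 2 + `|x - y| ^+ 2 = 2 * `|x| ^+ 2 + 2 * `|y| ^+ 2.

Lemma polarNr x y : polar x (- y) = - polar x y.
Proof. by rewrite /polar opprK normrN; have := parallelogram x y; lra. Qed.

(** Half of [h1 - h2 + h3]: the terms in [x - y] cancel between [h1] and [h2], those in
    [x + y - z - z] between [h2] and [h3]. *)
Lemma polarDl x y z : polar (x + y) z = polar x z + polar y z.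
Proof.
rewrite /polar.
have h1 := parallelogram x y.
have h2 := parallelogram (x - z) (y - z).
have h3 := parallelogram (x + y - z) z.
have e1 : x - z - (y - z) = x - y by rewrite opprB addrA subrK.
have e2 : x - z + (y - z) = x + y - z - z by rewrite addrACA -!addrA.
rewrite e1 e2 in h2; rewrite subrK in h3; lra.
Qed.

End Parallelogram.

(** For positive scalars, the factor [a * b] also comes out of the product of norms, so it cancels
    in the cosine. *)
Lemma pangle_homogeneous_polar :
  (forall x y a b, polar (a *: x) (b *: y) = a * b * polar x y) ->
  pangle_homogeneous X.
Proof.
move=> polarZ x y a b x0 y0 a0 b0.
rewrite !pangleE polarZ !normrZ !gtr0_norm //; congr acos.
by field; rewrite !normr_eq0 x0 y0 !gt_eqF.
Qed.

End Polar.

Theorem proposition3p1p1 (R : realType) (X : normedModType R) :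
  pangle_homogeneous X <-> derived_from_inner_product X.
Proof.
split=> [homX|[dot dotE]].
  have pl x y := parallelogram_of_homogeneous x y homX.
  have polarZl a (x y : X) : polar (a *: x) y = a * polar x y.
    rewrite polarC [in RHS]polarC; case: (ltrgt0P a) => [a0|a0|->].
    - exact: polarZr_gt0.
    (* A negative [a] is the opposite of the positive scalar [- a]; the parallelogram law lets the
       sign out. *)
    - rewrite -[a]opprK scaleNr polarNr // polarZr_gt0 ?oppr_gt0 //.
      by rewrite !mulNr.
    - by rewrite scale0r polar0r mul0r.
  have polar_gt0 (x : X) : x != 0 -> 0 < polar x x.
    by move=> x0; rewrite polarxx exprn_gt0 // normr_gt0.
  have [dot dotE] :=
    dot_of_form (@polarC R X) (polarDl pl) polarZl polar_gt0.
  by exists dot => x; rewrite dotE polarxx.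
have dotC x y : dot x y = dot y x.
  by rewrite hermitian_subproof expr0 mul1r.
have dotBl x y z : dot (x - y) z = dot x z - dot y z by exact: linearBl.
(* Polarization: expanding [dot (x - y) (x - y)] leaves twice the cross term. *)
have polar_dot x y : polar x y = dot x y.
  by rewrite /polar !dotE dotBl !(dotC _ (x - y)) !dotBl (dotC y x); field.
apply: pangle_homogeneous_polar => x y a b.
by rewrite !polar_dot linearZl_LR linearZr_LR /= mulrA.
Qed.
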